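(* Let $f:\mathbb{R}^n\to\mathbb{R}\cup\{+\infty\}$ be a lower semicontinuous function and assume that $\mathrm{Graph}\,f\subset\mathbb{R}^{n+1}$ admits a Whitney stratification $\mathcal{S}=(S_i)_{i\in I}$ such that $e_{n+1}\notin T_uS_i$ for all $i\in I$ and all $u\in S_i$, where $e_{n+1}=(0,\dots,0,1)\in\mathbb{R}^{n+1}$. For $x\in\mathrm{dom}\,f$ let $S_x$ be the stratum of $\mathcal{S}$ containing $(x,f(x))$, let $X_x=\Pi(S_x)$ be its projection to $\mathbb{R}^n$, and let $\nabla_R f(x)\in T_xX_x$ be the gradient at $x$ of $f|_{X_x}$. Then for all $x\in\mathrm{dom}\,f$ we have $$\mathrm{Proj}_{T_xX_x}\,\partial f(x)\subset\{\nabla_R f(x)\},\qquad \mathrm{Proj}_{T_xX_x}\,\partial^\infty f(x)=\{0\},$$ and $$\mathrm{Proj}_{T_xX_x}\,\partial^\circ f(x)\subset\{\nabla_R f(x)\},$$ where $\mathrm{Proj}_{\mathcal V}:\mathbb{R}^n\to\mathcal V$ denotes the orthogonal projection onto the vector subspace $\mathcal V$ of $\mathbb{R}^n$.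
   Context: $\mathbb{R}^n$ carries its canonical scalar product. For $f:\mathbb{R}^n\to\mathbb{R}\cup\{+\infty\}$: $\mathrm{dom}\,f=\{x: f(x)<+\infty\}$, $\mathrm{Graph}\,f=\{(x,f(x)):x\in\mathrm{dom}\,f\}\subset\mathbb{R}^n\times\mathbb{R}$; $f$ is lower semicontinuous if its epigraph $\{(x,\beta)\in\mathbb{R}^n\times\mathbb{R}:f(x)\le\beta\}$ is closed. Subdifferentials. For $x\in\mathrm{dom}\,f$, the Fréchet subdifferential $\hat\partial f(x)$ is the set of $x^*\in\mathbb{R}^n$ with $\liminf_{y\to x,\,y\ne x}\frac{f(y)-f(x)-\langle x^*,y-x\rangle}{\|y-x\|}\ge 0$. The limiting subdifferential $\partial f(x)$ is the set of $p$ for which there exist sequences $x_k$ and $x_k^*\in\hat\partial f(x_k)$ with $x_k\to x$, $f(x_k)\to f(x)$, $x_k^*\to p$. The asymptotic limiting subdifferential $\partial^\infty f(x)$ is the set of $q$ for which there exist $y_k$, $y_k^*\in\hat\partial f(y_k)$ and positive $t_k\searrow 0$ with $y_k\to x$, $f(y_k)\to f(x)$, $t_ky_k^*\to q$. The Clarke subdifferential is $\partial^\circ f(x)=\overline{\mathrm{co}}\,(\partial f(x)+\partial^\infty f(x))$ (closed convex hull of the Minkowski sum; it is empty if $\partial f(x)=\emptyset$). All these sets are empty if $x\notin\mathrm{dom}\,f$. Stratifications. A $C^p$ stratification ($p\ge1$ an integer) of a set $X\subset\mathbb{R}^m$ is a locally finite partition $(X_i)_{i\in I}$ of $X$ into $C^p$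 submanifolds of $\mathbb{R}^m$ (strata) such that for $i\ne j$, $\overline{X_i}\cap X_j\neq\emptyset$ implies $X_j\subset\overline{X_i}\setminus X_i$. It has the Whitney-(a) property if for all $i\neq j$, all $x\in\overline{X_i}\cap X_j$ and every sequence $(x_k)\subset X_i$ with $x_k\to x$ and $T_{x_k}X_i\to\mathcal T$, one has $T_xX_j\subset\mathcal T$. Convergence of subspaces is with respect to the gap $D(V,W)=\max\{\sup_{v\in V,\|v\|=1}d(v,W),\ \sup_{w\in W,\|w\|=1}d(w,V)\}$. A Whitney stratification is a $C^1$ stratification with the Whitney-(a) property. Projected strata. $\Pi:\mathbb{R}^{n+1}\to\mathbb{R}^n$, $\Pi(x_1,\dots,x_n,t)=(x_1,\dots,x_n)$. Since $\Pi$ is injective on $\mathrm{Graph}\,f$ and $e_{n+1}\notin T_uS_i$, each $X_i=\Pi(S_i)$ is regarded as a $C^1$ submanifold of $\mathbb{R}^n$ via the injective immersion $\Pi|_{S_i}$, with $T_xX_i=\Pi(T_{(x,f(x))}S_i)$, and $f|_{X_i}$ is a $C^1$ function on it. Each $X_i$ has the Riemannian metric induced by the Euclidean scalar product; $\nabla_Rf(x)$ is the unique vector of $T_xX_x$ such that $\langle\nabla_Rf(x),v\rangle=d(f|_{X_x})(x)(v)$ for all $v\in T_xX_x$. *)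

(* Defs.v *)
(* MathComp-Analysis; R^m is 'rV[R]_m for an arbitrary R : realType.  The
   library norm `|x| on 'rV[R]_m is the sup norm: it is used only through the
   topology and the notion of differentiability, which are those of the
   Euclidean norm.  Wherever lengths matter, the Euclidean norm [enorm] of the
   canonical scalar product [dot] is used. *)
From HB Require Import structures.
From mathcomp Require Export all_boot all_order all_algebra.
From mathcomp Require Export all_classical all_reals all_analysis.
Export Order.TTheory GRing.Theory Num.Theory.
Export numFieldNormedType.Exports.

Set Implicit Arguments.
Unset Strict Implicit.
Unset Printing Implicit Defensive.

#[global] Open Scope classical_set_scope.
#[global] Open Scope ring_scope.

Section Euclidean.
Context {R : realType} {m : nat}.
Implicit Types (u v : 'rV[R]_m) (V W A B : set 'rV[R]_m).

Definition dot u v : R := (u *m v^T) 0 0.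

Definition enorm u : R := Num.sqrt (dot u u).

Definition dist_to u W : R := inf [set enorm (u - w) | w in W].

(* Over R, sup set0 = 0: this is the value taken by the supremum over the unit
   sphere of the null subspace. *)
Definition gap V W : R :=
  Num.max (sup [set dist_to v W | v in V `&` [set v | enorm v = 1]])
          (sup [set dist_to w V | w in W `&` [set w | enorm w = 1]]).

(* The default value 0 is never used when V is a linear subspace. *)
Definition orth_proj V u : 'rV[R]_m :=
  xget 0 [set p | V p /\ forall w, V w -> dot (u - p) w = 0].

Definition minkowski_sum A B : set 'rV[R]_m :=
  [set a + b | a in A & b in B].

Definition convex_hull A : set 'rV[R]_m :=
  smallest (@convex_set R 'rV[R]_m) A.

End Euclidean.

Section Subdifferentials.
Context {R : realType} {n : nat}.
Variable f : 'rV[R]_n -> \bar R.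
Implicit Types (x p q : 'rV[R]_n).

Definition dom : set 'rV[R]_n := [set x | (f x < +oo)%E].

Definition epigraph : set ('rV[R]_n * R) := [set z | (f z.1 <= z.2%:E)%E].

Definition lsc : Prop := closed epigraph.

Definition frechet_subdiff x : set 'rV[R]_n :=
  [set p | dom x /\
    (0 <= limf_einf (fun y => (f y - f x - (dot p (y - x))%:E)
                              * ((enorm (y - x))^-1)%:E) x^')%E].

Definition limiting_subdiff x : set 'rV[R]_n :=
  [set p | dom x /\ exists xs ps : nat -> 'rV[R]_n,
    [/\ forall k, frechet_subdiff (xs k) (ps k),
        xs k @[k --> \oo] --> x,
        f (xs k) @[k --> \oo] --> f x
      & ps k @[k --> \oo] --> p]].

Definition asymptotic_subdiff x : set 'rV[R]_n :=
  [set q | dom x /\ exists (ys qs : nat -> 'rV[R]_n) (t : nat -> R),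
    [/\ (forall k, frechet_subdiff (ys k) (qs k)) /\
        [/\ forall k, 0 < t k, nonincreasing_seq t & t k @[k --> \oo] --> 0],
        ys k @[k --> \oo] --> x,
        f (ys k) @[k --> \oo] --> f x
      & t k *: qs k @[k --> \oo] --> q]].

Definition clarke_subdiff x : set 'rV[R]_n :=
  closure (convex_hull
    (minkowski_sum (limiting_subdiff x) (asymptotic_subdiff x))).

End Subdifferentials.

Section Submanifolds.
Context {R : realType} {m : nat}.
Implicit Types (U V S : set 'rV[R]_m) (u v : 'rV[R]_m).

(* To be used for U open. *)
Definition C1_on U (g : 'rV[R]_m -> 'rV[R]_m) : Prop :=
  forall y, U y -> differentiable g y /\ {for y, continuous (jacobian g)}.

Definition C1_diffeo U V (g h : 'rV[R]_m -> 'rV[R]_m) : Prop :=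
  [/\ open U /\ open V, C1_on U g, C1_on V h,
      forall y, U y -> V (g y) /\ h (g y) = y
    & forall z, V z -> U (h z) /\ g (h z) = z].

(* Embedded submanifold of dimension d: near each of its points, S is
   straightened to R^d x {0} by a C^1 diffeomorphism of the ambient space. *)
Definition C1_submanifold S : Prop :=
  exists2 d : nat, (d <= m)%N &
    forall u, S u -> exists U V g h,
      [/\ U u, C1_diffeo U V g h
        & forall y, U y -> (S y <-> forall j : 'I_m, (d <= j)%N -> g y 0 j = 0)].

(* c restricts to a C^1 curve in S on an open interval around 0. *)
Definition C1_curve_at S u (c : R -> 'rV[R]_m) : Prop :=
  c 0 = u /\ exists2 e : R, 0 < e &
    forall t, - e < t < e ->
      [/\ S (c t), derivable c t 1 & {for t, continuous (derive1 c)}].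

Definition tangent S u : set 'rV[R]_m :=
  [set v | exists2 c, C1_curve_at S u c & derive1 c 0 = v].

End Submanifolds.

Section Stratifications.
Context {R : realType} {m : nat} {I : Type}.
Variables (X : set 'rV[R]_m) (S : I -> set 'rV[R]_m).

Definition locally_finite : Prop :=
  forall u, X u -> exists2 U, nbhs u U & finite_set [set i | S i `&` U !=set0].

Definition C1_stratification : Prop :=
  [/\ partition setT S X, locally_finite, forall i, C1_submanifold (S i)
    & forall i j, i <> j -> closure (S i) `&` S j !=set0 ->
        S j `<=` closure (S i) `\` S i].

Definition whitney_a : Prop :=
  forall i j, i <> j -> forall x, (closure (S i) `&` S j) x ->
  forall (xs : nat -> 'rV[R]_m) (T : {vspace 'rV[R]_m}),
    (forall k, S i (xs k)) ->
    xs k @[k --> \oo] --> x ->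
    gap (tangent (S i) (xs k)) [set` T] @[k --> \oo] --> 0 ->
    tangent (S j) x `<=` [set` T].

Definition whitney_stratification : Prop := C1_stratification /\ whitney_a.

End Stratifications.

Section ProjectedStrata.
Context {R : realType} {n : nat}.

Definition Pi (u : 'rV[R]_(n + 1)) : 'rV[R]_n := lsubmx u.

Definition e_last : 'rV[R]_(n + 1) := row_mx 0 1%:M.

Variable f : 'rV[R]_n -> \bar R.

(* (x, f x); meaningful for f x finite. *)
Definition graph_pt (x : 'rV[R]_n) : 'rV[R]_(n + 1) :=
  row_mx x (fine (f x))%:M.

Definition graph : set 'rV[R]_(n + 1) := [set graph_pt x | x in dom f].

(* S is a stratum of the graph of f.  Its projection carries the manifold
   structure transported by the injective immersion Pi|_S, so that the C^1
   curves in it are the images under Pi of the C^1 curves in S. *)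
Variable S : set 'rV[R]_(n + 1).

Definition proj_tangent (x : 'rV[R]_n) : set 'rV[R]_n :=
  Pi @` tangent S (graph_pt x).

(* The differential at x of the restriction of f to Pi(S), in the direction v:
   the derivative at 0 of f along a C^1 curve of Pi(S) through x with
   velocity v. *)
Definition stratum_diff (x v : 'rV[R]_n) : R :=
  xget 0 [set a | exists c,
    [/\ C1_curve_at S (graph_pt x) c, Pi (derive1 c 0) = v
      & is_derive (0 : R) 1 (fun t => fine (f (Pi (c t)))) a]].

Definition riemannian_gradient (x : 'rV[R]_n) : 'rV[R]_n :=
  xget 0 [set g | proj_tangent x g /\
    forall v, proj_tangent x v -> dot g v = stratum_diff x v].

End ProjectedStrata.

(* Main.v *)
From mathcomp Require Import lra.
Require Import Defs.

(** A sequence of Fréchet subgradients is a sequence of normal directions to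
    the strata of the graph, and the Whitney-(a) property lets such normal
    directions pass to the limit.

    If y* is a Fréchet subgradient of f at y, then f(z) >= f(y) + <y*, z - y> -
    o(|z - y|).  Following a C^1 curve of the stratum through (y, f(y)), with
    velocity v and then with velocity -v, shows that (y*, -1) is orthogonal to
    the tangent space of that stratum ([frechet_normal]).

    Let (x_k, f(x_k)) tend to (x, f(x)), a point of the stratum S_i.  By local
    finiteness infinitely many terms lie in one stratum S_j.  If j = i, tangent
    spaces vary continuously along S_i.  If j <> i, the tangent spaces to S_j
    accumulate, by compactness of the Grassmannian ([grassmannian_compact]), at
    a subspace that contains T S_i by the Whitney-(a) property.  Either way
    every tangent vector v of S_i at (x, f(x)) is a limit of tangent vectors at
    the points of a subsequence ([whitney_tangent_limits]).  Orthogonality then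
    passes to the limit ([limiting_normal]): (p, -1) _|_ v for p in the limiting
    subdifferential, and, multiplying first by t_k -> 0, (q, 0) _|_ v for q in
    the asymptotic one.

    For v = (w, a) with w in T_x X_x the first relation reads <p, w> = a, and a
    is the derivative of f along X_x in the direction w; so p and the Riemannian
    gradient have the same products with T_x X_x.  The second says that q is
    orthogonal to T_x X_x.  The set of all p satisfying the first relation is
    closed, convex and stable under adding such q, hence contains the Clarke
    subdifferential.

    The equality, rather than an inclusion, in the asymptotic case also needs
    that 0 is an asymptotic subgradient ([asymptotic_subdiff0]): minimizing
    f + lam |. - x|^2 near x produces Fréchet subgradients y_k* at points with
    (y_k, f(y_k)) -> (x, f(x)), and t_k can be chosen so small that
    t_k y_k* -> 0. *)

Set Implicit Arguments.
Unset Strict Implicit.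
Unset Printing Implicit Defensive.

(** * The canonical scalar product *)

Lemma norm_entry_le (R : realType) p q (N : 'M[R]_(p, q)) i j :
  `|N i j| <= `|N|.
Proof.
rewrite [leRHS]/Num.norm/= mx_normrE.
exact: (le_bigmax _ (fun ij : 'I_p * 'I_q => `|N ij.1 ij.2|) (i, j)).
Qed.

Section Dot.
Context {R : realType} {m : nat}.
Implicit Types (u v w : 'rV[R]_m).

Lemma dotE u v : dot u v = \sum_i u 0 i * v 0 i.
Proof. by rewrite /dot mxE; apply: eq_bigr => i _; rewrite mxE. Qed.

Lemma dotC u v : dot u v = dot v u.
Proof. by rewrite !dotE; apply: eq_bigr => i _; rewrite mulrC. Qed.

Lemma dotDl u v w : dot (u + v) w = dot u w + dot v w.
Proof. by rewrite /dot mulmxDl mxE. Qed.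

Lemma dotZl a u w : dot (a *: u) w = a * dot u w.
Proof. by rewrite /dot -scalemxAl mxE. Qed.

Lemma dotNl u w : dot (- u) w = - dot u w.
Proof. by rewrite -scaleN1r dotZl mulN1r. Qed.

Lemma dotBl u v w : dot (u - v) w = dot u w - dot v w.
Proof. by rewrite dotDl dotNl. Qed.

Lemma dotDr u v w : dot w (u + v) = dot w u + dot w v.
Proof. by rewrite dotC dotDl !(dotC w). Qed.

Lemma dotZr a u w : dot w (a *: u) = a * dot w u.
Proof. by rewrite dotC dotZl (dotC w). Qed.

Lemma dotNr u w : dot w (- u) = - dot w u.
Proof. by rewrite dotC dotNl (dotC w). Qed.

Lemma dot0l w : dot 0 w = 0.
Proof. by rewrite -(scale0r (0 : 'rV_m)) dotZl mul0r. Qed.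

Lemma dot_ge0 u : 0 <= dot u u.
Proof. by rewrite dotE sumr_ge0// => i _; rewrite -expr2 sqr_ge0. Qed.

Lemma dot_eq0 u : dot u u = 0 -> u = 0.
Proof.
rewrite dotE => /eqP; rewrite psumr_eq0; last first.
  by move=> i _; rewrite -expr2 sqr_ge0.
move=> /allP u0; apply/rowP => i; rewrite mxE.
have /implyP/(_ isT) := u0 i (mem_index_enum i).
by rewrite mulf_eq0 orbb => /eqP.
Qed.

Lemma enorm_ge0 u : 0 <= enorm u.
Proof. exact: sqrtr_ge0. Qed.

Lemma sqr_enorm u : enorm u ^+ 2 = dot u u.
Proof. by rewrite sqr_sqrtr// dot_ge0. Qed.

Lemma enormN u : enorm (- u) = enorm u.
Proof. by rewrite /enorm dotNl dotNr opprK. Qed.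

(** The norm of a row as a matrix is its sup norm; this bound and the next one
    make it equivalent to the Euclidean norm. *)
Lemma norm_le_enorm u : `|u| <= enorm u.
Proof.
rewrite [leLHS]/Num.norm/= mx_normrE; apply/bigmax_leP; split=> [|[i j] _ /=].
  exact: enorm_ge0.
rewrite (ord1 i) -sqrtr_sqr ler_wsqrtr// dotE (bigD1 j)//= -expr2 lerDl.
by rewrite sumr_ge0// => k _; rewrite -expr2 sqr_ge0.
Qed.

Lemma enorm_le_mul u (C : R) : `|u| <= C -> enorm u <= Num.sqrt m%:R * C.
Proof.
move=> uC; have C0 : 0 <= C by apply: le_trans uC.
rewrite -(ger0_norm C0) -sqrtr_sqr -sqrtrM ?ler0n//.
rewrite ler_wsqrtr// dotE mulr_natl.
rewrite -[X in _ <= _ *+ X](card_ord m) -sumr_const; apply: ler_sum => j _.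
rewrite -expr2 -real_normK ?num_real// lerXn2r ?nnegrE//.
exact: le_trans (norm_entry_le u 0 j) uC.
Qed.

End Dot.

Lemma enorm_gt0 (R : realType) m (u : 'rV[R]_m) : u != 0 -> 0 < enorm u.
Proof.
move=> u0; rewrite lt_neqAle enorm_ge0 andbT eq_sym.
apply: contra u0 => /eqP u0; apply/eqP/dot_eq0.
by rewrite -sqr_enorm u0 expr0n.
Qed.

Lemma enormZ (R : realType) m a (u : 'rV[R]_m) : 0 <= a ->
  enorm (a *: u) = a * enorm u.
Proof.
move=> a0; rewrite /enorm dotZl dotZr mulrA sqrtrM ?mulr_ge0//.
by rewrite -expr2 sqrtr_sqr ger0_norm.
Qed.

(** * Limits of matrices *)

Section MatrixLimits.
Context {R : realType} {T : Type} {F : set_system T} {FF : ProperFilter F}.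

Lemma cvg_mxP m n (A : T -> 'M[R]_(m, n)) (B : 'M[R]_(m, n)) :
  A @ F --> B <-> forall i j, A t i j @[t --> F] --> B i j.
Proof.
split=> [AB i j|AB].
  apply: (cvg_comp A (fun M : 'M[R]_(m, n) => M i j) AB).
  exact: coord_continuous.
apply/cvgrPdist_lt => e e0.
have : forall ij : 'I_m * 'I_n,
    \forall t \near F, `|B ij.1 ij.2 - A t ij.1 ij.2| < e.
  by move=> ij; move/cvgrPdist_lt: (AB ij.1 ij.2); apply.
move=> /filter_forall; apply: filterS => t Bt.
rewrite /Num.norm/= mx_normrE; apply/bigmax_ltP; split=> // ij _.
by have := Bt ij; rewrite !mxE.
Qed.

Lemma cvg_mulmx m n p (A : T -> 'M[R]_(m, n)) (B : T -> 'M[R]_(n, p))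
    (a : 'M[R]_(m, n)) (b : 'M[R]_(n, p)) :
  A @ F --> a -> B @ F --> b -> A t *m B t @[t --> F] --> a *m b.
Proof.
move=> /cvg_mxP Aa /cvg_mxP Bb; apply/cvg_mxP => i j; rewrite mxE.
under eq_fun do rewrite mxE.
by apply: cvg_big => [|k _]; [exact: add_continuous|exact: cvgM].
Qed.

Lemma cvg_trmx m n (A : T -> 'M[R]_(m, n)) (a : 'M[R]_(m, n)) :
  A @ F --> a -> (A t)^T @[t --> F] --> a^T.
Proof.
move=> /cvg_mxP Aa; apply/cvg_mxP => i j; rewrite mxE.
by under eq_fun do rewrite mxE; exact: Aa.
Qed.

Lemma cvg_row_mx m n1 n2 (A : T -> 'M[R]_(m, n1)) (B : T -> 'M[R]_(m, n2))
    (a : 'M[R]_(m, n1)) (b : 'M[R]_(m, n2)) :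
  A @ F --> a -> B @ F --> b -> row_mx (A t) (B t) @[t --> F] --> row_mx a b.
Proof.
move=> /cvg_mxP Aa /cvg_mxP Bb; apply/cvg_mxP => i j; rewrite mxE.
under eq_fun do rewrite mxE.
by case: fintype.splitP => k _; [exact: Aa|exact: Bb].
Qed.

Lemma cvg_scalar_mx (c : T -> R) n (a : R) :
  c @ F --> a -> (c t)%:M @[t --> F] --> (a%:M : 'M[R]_n).
Proof.
move=> ca; apply/cvg_mxP => i j; rewrite mxE.
under eq_fun do rewrite mxE.
by apply: cvgMn.
Qed.

Lemma cvg_dot m (u v : T -> 'rV[R]_m) (a b : 'rV[R]_m) :
  u @ F --> a -> v @ F --> b -> dot (u t) (v t) @[t --> F] --> dot a b.
Proof.
by move=> ua vb; move/cvg_mxP: (cvg_mulmx ua (cvg_trmx vb)); apply.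
Qed.

Lemma cvg_enorm m (u : T -> 'rV[R]_m) (a : 'rV[R]_m) :
  u @ F --> a -> enorm (u t) @[t --> F] --> enorm a.
Proof.
move=> ua; apply: (cvg_comp _ _ (cvg_dot ua ua)).
exact: sqrt_continuous.
Qed.

End MatrixLimits.

(** * Extraction of convergent subsequences *)

(** Subsequences are indexed by maps phi with k <= phi k instead of strictly
    increasing ones: this is all that convergence needs, and such maps are
    obtained by independent choices for each k and are stable by
    composition. *)
Lemma cvg_subseq (phi : nat -> nat) :
  (forall k, k <= phi k)%N -> phi k @[k --> \oo] --> \oo.
Proof.
move=> kphi A [N _ NA]; exists N => // k /= Nk; apply: NA => /=.
exact: leq_trans (kphi k).
Qed.

Lemma frequently_subseq (P : nat -> nat -> Prop) :
  (forall k N, exists2 l, (N <= l)%N & P k l) ->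
  exists2 phi : nat -> nat, (forall k, k <= phi k)%N & forall k, P k (phi k).
Proof.
move=> Pfreq.
have /choice[phi Pphi] : forall k, exists l, (k <= l)%N /\ P k l.
  by move=> k; have [l] := Pfreq k k; exists l.
by exists phi => k; have [] := Pphi k.
Qed.

Lemma cvg_harmonic_dist (R : realType) (V : normedModType R) (g : nat -> V) l :
  (forall k, `|l - g k| <= k.+1%:R^-1) -> g @ \oo --> l.
Proof.
move=> gl; apply/cvgrPdist_lt => e e0; have := @cvg_harmonic R.
move/cvgrPdist_lt => /(_ e e0); apply: filterS => k.
by rewrite sub0r normrN ger0_norm ?invr_ge0//; apply: le_lt_trans.
Qed.

Lemma bounded_subseq (R : realType) m (u : nat -> 'rV[R]_m) (C : R) :
  (forall k, `|u k| <= C) ->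
  exists phi (l : 'rV[R]_m),
    (forall k, k <= phi k)%N /\ u (phi k) @[k --> \oo] --> l.
Proof.
move=> uC; pose K : set 'rV[R]_m := [set v | `|v| <= C].
have cK : compact K.
  apply: bounded_closed_compact.
    exists C; split=> [|M CM v /= vC]; first exact: num_real.
    exact: le_trans (ltW CM).
  apply: (@closed_comp _ _ (fun v : 'rV[R]_m => `|v|) [set x | x <= C]).
    by move=> v _; exact: norm_continuous.
  exact: closed_le.
have [|l [_ ul]] := cK (u @ \oo) _.
  by exists 0%N => // k _; exact: uC.
(* A cluster point is approached within 1/(k+1) at arbitrarily late indices. *)
have ufreq : forall k N, exists2 j, (N <= j)%N & `|l - u j| < k.+1%:R^-1.
  move=> k N; have [||v [[j Nj <-]] uj] :=
    ul [set u j | j in [set j | (N <= j)%N]] (ball l k.+1%:R^-1).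
  - by exists N => // j /= Nj; exists j.
  - by apply: nbhsx_ballx; rewrite invr_gt0.
  - by exists j => //; rewrite -ball_normE in uj.
have [phi kphi uphi] := frequently_subseq ufreq.
exists phi, l; split=> //; apply: cvg_harmonic_dist => k.
exact: ltW (uphi k).
Unshelve. all: by end_near. Qed.

(** * Orthogonal projectors and convergence of subspaces *)

(** In coordinates a subspace is the row space of a matrix A, and its orthogonal
    complement is the kernel of A^T.  The two meet in 0 by definiteness, so they
    are complementary by a dimension count, and projecting along the latter is
    the orthogonal projection. *)
Lemma orthogonal_projector (R : realType) m n (A : 'M[R]_(n, m)) :
  exists P : 'M[R]_m,
    [/\ forall v : 'rV_m, (v <= A)%MS -> v *m P = v,
        forall v : 'rV_m, (v *m P <= A)%MS
      & forall v w : 'rV_m, (w <= A)%MS -> dot (v - v *m P) w = 0].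
Proof.
pose B := <<A>>%MS; pose K := kermx B^T.
have KB (v w : 'rV[R]_m) : (v <= K)%MS -> (w <= B)%MS -> dot v w = 0.
  move=> /sub_kermxP vB /submxP[x ->].
  by rewrite /dot trmx_mul mulmxA vB mul0mx mxE.
have BK0 : (B :&: K = 0)%MS.
  apply/eqP/rowV0P => v; rewrite sub_capmx => /andP[vB vK].
  by apply: dot_eq0; exact: KB.
have BKfull : row_full (B + K)%MS.
  rewrite /row_full mxrank_disjoint_sum// mxrank_ker mxrank_tr subnKC//.
  exact: rank_leq_row.
exists (proj_mx B K); split=> [v vA|v|v w wA].
- by rewrite proj_mx_id// genmxE.
- by rewrite -(genmxE A) proj_mx_sub.
- by apply: KB; [exact/proj_mx_compl_sub/submx_full|rewrite genmxE].
Qed.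

Lemma projector_enorm_le (R : realType) m n (A : 'M[R]_(n, m)) (P : 'M[R]_m) :
  (forall v : 'rV_m, (v *m P <= A)%MS) ->
  (forall v w : 'rV_m, (w <= A)%MS -> dot (v - v *m P) w = 0) ->
  forall v : 'rV_m, enorm (v *m P) <= enorm v.
Proof.
move=> PA Pdot v; rewrite /enorm ler_wsqrtr//.
have := Pdot v _ (PA v); set a := v *m P; set b := v - a => ba.
have -> : v = a + b by rewrite addrC subrK.
move: ba; clearbody a b => ba.
by rewrite dotDl !dotDr (dotC a b) ba addr0 add0r lerDl dot_ge0.
Qed.

Section Gap.
Context {R : realType} {m : nat}.
Implicit Types (V W : set 'rV[R]_m).

Lemma dist_to_ge0 V v : 0 <= dist_to v V.
Proof.
rewrite /dist_to; set D := [set _ | _ in _].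
have [->|/set0P D0] := eqVneq D set0; first by rewrite inf0.
by apply: lb_le_inf => // _ [w _ <-]; exact: enorm_ge0.
Qed.

Lemma dist_to_le V v w : V w -> dist_to v V <= enorm (v - w).
Proof.
move=> Vw; apply: ge_inf; last by exists w.
by exists 0 => _ [u _ <-]; exact: enorm_ge0.
Qed.

(** Both bounds matter, since the convergence of the gap to 0 is about its
    absolute value. *)
Lemma sup_dist_to_le V W C : 0 <= C ->
  (forall v, V v -> enorm v = 1 -> exists2 w, W w & enorm (v - w) <= C) ->
  0 <= sup [set dist_to v W | v in V `&` [set v | enorm v = 1]] <= C.
Proof.
move=> C0 VWC; set D := [set _ | _ in _].
have DC : ubound D C.
  move=> _ [v [Vv v1] <-]; have [w Ww] := VWC v Vv v1.
  by apply: le_trans; exact: dist_to_le.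
have [->|/set0P D0] := eqVneq D set0; first by rewrite sup0 lexx.
apply/andP; split; last exact: ge_sup.
have [d Dd] := D0; apply: (@le_trans _ _ d).
  by case: Dd => v _ <-; exact: dist_to_ge0.
by apply: sup_upper_bound => //; split=> //; exists C.
Qed.

Lemma gap_norm_le V W C : 0 <= C ->
  (forall v, V v -> enorm v = 1 -> exists2 w, W w & enorm (v - w) <= C) ->
  (forall w, W w -> enorm w = 1 -> exists2 v, V v & enorm (w - v) <= C) ->
  `|gap V W| <= C.
Proof.
move=> C0 /(sup_dist_to_le C0)/andP[VW0 VWC] /(sup_dist_to_le C0)/andP[_ WVC].
by rewrite ger0_norm ?le_max ?VW0// ge_max VWC.
Qed.

End Gap.

Lemma enorm_mulmx_le (R : realType) m (v : 'rV[R]_m) (M : 'M[R]_m) :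
  enorm v = 1 -> enorm (v *m M) <= Num.sqrt m%:R * (m%:R * `|M|).
Proof.
move=> v1; apply: enorm_le_mul.
rewrite [leLHS]/Num.norm/= mx_normrE; apply/bigmax_leP; split=> [|[i j] _ /=].
  by rewrite mulr_ge0.
rewrite mxE; apply: le_trans (ler_norm_sum _ _ _) _.
rewrite mulr_natl -[X in _ <= _ *+ X](card_ord m) -sumr_const.
apply: ler_sum => k _; rewrite normrM -[leRHS]mul1r ler_pM//.
  by apply: le_trans (norm_entry_le v i k) _; rewrite -v1 norm_le_enorm.
exact: norm_entry_le.
Qed.

(** Sequential compactness of the Grassmannian for the gap.  The orthogonal
    projectors onto the given subspaces have norm at most 1, so a subsequence of
    them converges to a matrix Q; Q is idempotent as a limit of idempotents, and
    T is its image.  The gap is controlled by the distance between projectors,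
    because v and its projection v *m P differ by v *m (Q - P) for v in T, and
    symmetrically. *)
Lemma grassmannian_compact (R : realType) m n (A : nat -> 'M[R]_(n, m)) :
  exists (phi : nat -> nat) (T : {vspace 'rV[R]_m}),
    [/\ forall k, (k <= phi k)%N,
        gap [set v | (v <= A (phi k))%MS] [set` T] @[k --> \oo] --> 0
      & forall v, v \in T -> exists2 vs : nat -> 'rV[R]_m,
          forall k, (vs k <= A (phi k))%MS & vs k @[k --> \oo] --> v].
Proof.
have /choice[P AP] := fun k => orthogonal_projector (A k).
have P1 k : `|mxvec (P k)| <= 1.
  rewrite [leLHS]/Num.norm/= mx_normrE; apply/bigmax_leP.
  split=> // -[i l] _ /=.
  rewrite (ord1 i); case/mxvec_indexP: l => a b; rewrite mxvecE.
  have [_ PA Pdot] := AP k.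
  have -> : P k a b = (row a 1%:M *m P k) 0 b by rewrite -row_mul mul1mx mxE.
  apply: le_trans (norm_entry_le _ _ _) _.
  apply: le_trans (norm_le_enorm _) _.
  apply: le_trans (projector_enorm_le PA Pdot _) _.
  by rewrite /enorm /dot row1 trmx_delta mul_delta_mx mxE !eqxx sqrtr1.
have [phi [l [kphi Pl]]] := bounded_subseq P1.
pose Q : 'M[R]_m := vec_mx l.
have PQ : P (phi k) @[k --> \oo] --> Q.
  apply/cvg_mxP => i j; move/cvg_mxP: Pl => /(_ 0 (mxvec_index i j)).
  rewrite /Q mxE; by under eq_fun do rewrite mxvecE.
have PP k : P k *m P k = P k.
  have [PA AP' _] := AP k; apply/row_matrixP => i.
  by rewrite row_mul PA// rowE AP'.
have QQ : Q *m Q = Q.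
  have PPQ : P (phi k) *m P (phi k) @[k --> \oo] --> Q.
    by under eq_fun do rewrite PP.
  exact: cvg_unique (cvg_mulmx PQ PQ) PPQ.
pose T : {vspace 'rV[R]_m} := limg (linfun (@mulmxr R 1 m m Q)).
have TP v : v \in T -> v *m Q = v.
  by case/memv_imgP => w _ ->; rewrite lfunE/= -mulmxA QQ.
exists phi, T; split=> //.
- have PQ0 : Num.sqrt m%:R * (m%:R * `|P (phi k) - Q|) @[k --> \oo] --> (0 : R).
    rewrite -(mulr0 (Num.sqrt m%:R)); apply: cvgMr.
    rewrite -(mulr0 m%:R); apply: cvgMr.
    rewrite -(normr0 'M[R]_m) -(subrr Q).
    by apply: cvg_norm; apply: cvgB => //; exact: cvg_cst.
  apply/cvgrPdist_lt => e e0; move/cvgrPdist_lt: PQ0 => /(_ _ e0).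
  apply: filterS => k; rewrite !sub0r !normrN; apply: le_lt_trans.
  have [PA PA' _] := AP (phi k).
  rewrite [leRHS]ger0_norm ?mulr_ge0 ?sqrtr_ge0//.
  apply: gap_norm_le => [|v /= vA v1|w /= wT w1].
  + by rewrite ?mulr_ge0 ?sqrtr_ge0.
  + exists (v *m Q); last by rewrite -{1}(PA v vA) -mulmxBr enorm_mulmx_le.
    by apply/memv_imgP; exists v; rewrite ?memvf// lfunE.
  + exists (w *m P (phi k)) => //=.
    by rewrite -{1}(TP w wT) -mulmxBr -enormN -mulmxN opprB enorm_mulmx_le.
- move=> v vT; exists (fun k => v *m P (phi k)) => [k|].
    by have [_ PA' _] := AP (phi k).
  by rewrite -[X in _ --> X](TP v vT); apply: cvg_mulmx => //; exact: cvg_cst.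
Qed.

(** * Tangent spaces of submanifolds in charts *)

Section Curves.
Context {R : realType}.

Lemma derive1_comp_jacobian m n
    (g : 'rV[R]_m -> 'rV[R]_n) (c : R -> 'rV[R]_m) t :
  derivable c t 1 -> differentiable g (c t) ->
  derivable (g \o c) t 1 /\
  derive1 (g \o c) t = derive1 c t *m jacobian g (c t).
Proof.
move=> /derivable1_diffP ct gc; have gct := differentiable_comp ct gc.
split; first exact/derivable1_diffP.
by rewrite !derive1E'// diff_comp//= /jacobian mul_rV_lin1.
Qed.

Lemma near_eq_derive1 m (c1 c2 : R -> 'rV[R]_m) t :
  (\forall s \near t, c1 s = c2 s) -> derive1 c1 t = derive1 c2 t.
Proof. by move=> c12; rewrite !derive1E; apply: near_eq_derive. Qed.

Lemma derive1_mulmx m n (c : R -> 'rV[R]_m) (D : 'M[R]_(m, n)) t :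
  derivable c t 1 -> derive1 (fun s => c s *m D) t = derive1 c t *m D.
Proof.
move=> ct; pose f : {linear 'rV[R]_m -> 'rV[R]_n} := @mulmxr R 1 m n D.
have fcont : continuous f.
  move=> x; apply: (@cvg_mulmx R _ (nbhs x) _ 1 m n id (fun=> D)).
    exact: cvg_id.
  exact: cvg_cst.
have fd := @linear_differentiable _ _ _ f (c t) fcont.
have [_ ->] := derive1_comp_jacobian ct fd.
by rewrite /jacobian mul_rV_lin1 (diff_lin _ fcont).
Qed.

Lemma derivable_line m (a w : 'rV[R]_m) t :
  derivable (fun s : R => a + s *: w) t 1 /\
  derive1 (fun s : R => a + s *: w) t = w.
Proof.
have zis : is_diff t (fun s : R => a + s *: w) ( *:%R ^~ w).
  by apply: is_diff_eq; rewrite add0r.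
split; first by exact/derivable1_diffP.
by rewrite derive1E'// diff_val scale1r.
Qed.

Lemma C1_curve_derivable m S u (c : R -> 'rV[R]_m) :
  C1_curve_at S u c -> derivable c 0 1.
Proof.
case=> _ [e e0 ce]; have e00 : - e < 0 < e by rewrite oppr_lt0 e0.
by case: (ce 0 e00) => _ cd _; exact: cd.
Qed.

Lemma derivable1_continuous m (c : R -> 'rV[R]_m) t :
  derivable c t 1 -> {for t, continuous c}.
Proof.
by move=> ct; apply: differentiable_continuous; exact/derivable1_diffP.
Qed.

Lemma C1_curve_near m S u (c : R -> 'rV[R]_m) :
  C1_curve_at S u c -> \forall t \near 0, S (c t).
Proof.
case=> _ [e e0 ce]; have : \forall t \near (0 : R), `|t| < e.
  by apply/nbhs_normP; exists e => // t /=; rewrite sub0r normrN.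
by apply: filterS => t; rewrite ltr_norml => /ce[].
Qed.

End Curves.

Section ChartTangent.
Context {R : realType} {m : nat}.
Variables (S : set 'rV[R]_m) (d : nat) (U V : set 'rV[R]_m).
Variables (g h : 'rV[R]_m -> 'rV[R]_m).
Hypothesis dm : (d <= m)%N.
Hypothesis gh : C1_diffeo U V g h.
Hypothesis SU : forall y, U y ->
  (S y <-> forall j : 'I_m, (d <= j)%N -> g y 0 j = 0).

(** The coordinate conditions of a chart become a matrix equation, which can be
    differentiated along a curve. *)
Lemma mulmx_pid (x : 'rV[R]_m) :
  (forall j : 'I_m, (d <= j)%N -> x 0 j = 0) <-> x *m pid_mx d = x.
Proof.
have E j : (x *m (pid_mx d : 'M[R]_m)) 0 j = if (j < d)%N then x 0 j else 0.
  rewrite mxE (bigD1 j)//= mxE eqxx/= big1 ?addr0 => [|i ij].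
    by case: ifP => _; rewrite ?mulr1 ?mulr0.
  by rewrite mxE (_ : (i == j :> nat) = false) ?mulr0//; apply/negbTE.
split=> [xd|<- j dj]; last by rewrite E ltnNge dj.
by apply/rowP => j; rewrite E; case: ltnP => // /xd.
Qed.

(** Near 0 a curve c of S is h \o (g \o c), and g \o c stays in R^d x {0}, so
    its velocity is there too. *)
Lemma chart_tangent_sub u : U u ->
  tangent S u `<=` [set v | (v <= (pid_mx d : 'M[R]_m) *m jacobian h (g u))%MS].
Proof.
move=> Uu _ [c cS <-] /=; have [[oU oV] gC1 hC1 gU hV] := gh.
have [Vgu hgu] := gU _ Uu.
have c0d := C1_curve_derivable cS; have [c0 _] := cS.
have cU : \forall t \near 0, U (c t) /\ S (c t).
  apply: filterI; last exact: C1_curve_near cS.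
  by apply: (derivable1_continuous c0d); rewrite c0; exact: open_nbhs_nbhs.
rewrite -c0 in Uu Vgu hgu *.
have [gcd gc1] := derive1_comp_jacobian c0d (gC1 _ Uu).1.
have [_ hgc1] := derive1_comp_jacobian gcd (hC1 _ Vgu).1.
have -> : derive1 c 0 = derive1 (h \o (g \o c)) 0.
  apply: near_eq_derive1; apply: filterS cU => t [Ut _] /=.
  by rewrite (gU _ Ut).2.
rewrite hgc1 /=.
have <- : derive1 (g \o c) 0 *m pid_mx d = derive1 (g \o c) 0.
  rewrite -derive1_mulmx//; apply: near_eq_derive1.
  by apply: filterS cU => t [Ut St] /=; apply/mulmx_pid; exact/SU.
by rewrite -mulmxA submxMl.
Qed.

(** The image by h of the line g u + t w, with w in R^d x {0}, is a curve of
    S. *)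
Lemma chart_sub_tangent u : U u -> S u ->
  [set v | (v <= (pid_mx d : 'M[R]_m) *m jacobian h (g u))%MS] `<=` tangent S u.
Proof.
move=> Uu Su _ /submxP[x ->]; have [[oU oV] gC1 hC1 gU hV] := gh.
have [Vgu hgu] := gU _ Uu.
rewrite mulmxA; set w := x *m (pid_mx d : 'M[R]_m).
have wd (j : 'I_m) : (d <= j)%N -> w 0 j = 0.
  by move: j; apply/mulmx_pid; rewrite /w -mulmxA pid_mx_id.
clearbody w.
pose z (t : R) := g u + t *: w.
have zd t : derivable z t 1 by have [] := derivable_line (g u) w t.
have z1 t : derive1 z t = w by have [] := derivable_line (g u) w t.
have zcont t : {for t, continuous z} by exact: derivable1_continuous.
have z0 : z 0 = g u by rewrite /z scale0r addr0.
have zE t j : z t 0 j = g u 0 j + t * w 0 j by rewrite !mxE.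
clearbody z.
have zV : \forall t \near 0, V (z t).
  by apply: zcont; rewrite z0; exact: open_nbhs_nbhs.
have /nbhs_normP[e /= e0 eV] := zV.
have eV' t : - e < t < e -> V (z t).
  by move=> te; apply: eV; rewrite /= sub0r normrN ltr_norml.
have hz t : V (z t) -> derivable (h \o z) t 1 /\
    derive1 (h \o z) t = w *m jacobian h (z t).
  move=> Vz; have [hzd hz1] := derive1_comp_jacobian (zd t) (hC1 _ Vz).1.
  by split; rewrite // hz1 z1.
exists (h \o z); last by have [] := hz 0; rewrite z0.
split; first by rewrite /= z0.
exists e; first exact: e0.
move=> t te; have Vt := eV' t te.
have [hzd hz1] := hz t Vt; split; [|exact: hzd|].
  have [Uht ghz] := hV _ Vt.
  apply/SU => // j dj; rewrite /= ghz zE wd// mulr0 addr0.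
  by move: j dj; exact/SU.
change (derive1 (h \o z) @ t --> derive1 (h \o z) t); rewrite hz1.
have : w *m jacobian h (z s) @[s --> t] --> w *m jacobian h (z t).
  apply: (cvg_mulmx (F := nbhs t) (A := fun=> w)
    (B := fun s => jacobian h (z s))).
    exact: cvg_cst.
  exact: (cvg_comp _ _ (zcont t) (hC1 _ Vt).2).
apply: cvg_trans; apply: near_eq_cvg.
have : \forall s \near t, V (z s) by apply: zcont; exact: open_nbhs_nbhs.
by apply: filterS => s Vs; exact: esym (hz s Vs).2.
Qed.

Lemma chart_tangent u : U u -> S u ->
  tangent S u = [set v | (v <= (pid_mx d : 'M[R]_m) *m jacobian h (g u))%MS].
Proof.
move=> Uu Su; apply/seteqP; split; first exact: chart_tangent_sub.
exact: chart_sub_tangent.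
Qed.

End ChartTangent.

(** * Limits of tangent spaces along a Whitney stratification *)

Section TangentLimits.
Context {R : realType} {m : nat}.
Implicit Types (S : set 'rV[R]_m) (u v : 'rV[R]_m) (us vs : nat -> 'rV[R]_m).

Lemma tangent_rowspace S u : C1_submanifold S -> S u ->
  exists A : 'M[R]_m, tangent S u = [set v | (v <= A)%MS].
Proof.
move=> [d dm charts] Su; have [U [V [g [h [Uu gh SU]]]]] := charts u Su.
by rewrite (chart_tangent dm gh SU Uu Su); eexists.
Qed.

(** A chart at u is also a chart at the nearby points of S, and there the
    tangent space is the image of a fixed space by a matrix depending
    continuously on the point. *)
Lemma tangent_continuous S u v us : C1_submanifold S -> S u ->
  tangent S u v -> (forall k, S (us k)) -> us @ \oo --> u ->
  exists phi vs, [/\ forall k, (k <= phi k)%N,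
    forall k, tangent S (us (phi k)) (vs k) & vs @ \oo --> v].
Proof.
move=> [d dm charts] Su Tv Sus usu.
have [U [V [g [h [Uu gh SU]]]]] := charts u Su.
have [[oU oV] gC1 hC1 gU hV] := gh.
move: Tv; rewrite (chart_tangent dm gh SU Uu Su) => /submxP[x ->].
have [N _ NU] : \forall k \near \oo, U (us k).
  by apply: usu; exact: open_nbhs_nbhs.
pose phi k := (k + N)%N.
have kphi k : (k <= phi k)%N by exact: leq_addr.
exists phi, (fun k => x *m (pid_mx d *m jacobian h (g (us (phi k))))).
split; [exact: kphi|move=> k|].
  have Uk : U (us (phi k)) by apply: NU => /=; exact: leq_addl.
  by rewrite (chart_tangent dm gh SU Uk (Sus _)) /= submxMl.
have usphi : us (phi k) @[k --> \oo] --> u.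
  exact: (cvg_comp _ _ (cvg_subseq kphi) usu).
have gus := cvg_comp _ _ usphi (differentiable_continuous (gC1 _ Uu).1).
have hus := cvg_comp _ _ gus (hC1 _ (gU _ Uu).1).2.
apply: (cvg_mulmx (F := \oo) (A := fun=> x)); first exact: cvg_cst.
apply: (cvg_mulmx (F := \oo) (A := fun=> pid_mx d)); first exact: cvg_cst.
exact: hus.
Qed.

(** Pigeonhole principle: otherwise each of the finitely many pieces would be
    left for good after some index. *)
Lemma frequently_one_piece (I T : Type) (D : set I) (S : I -> set T)
    (us : nat -> T) : finite_set D ->
  (\forall k \near \oo, exists2 i, D i & S i (us k)) ->
  exists i, forall N, exists2 k, (N <= k)%N & S i (us k).
Proof.
move=> finD usD; apply: contrapT => noi.
have /choice[N NS] : forall i, exists N, forall k, (N <= k)%N -> ~ S i (us k).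
  move=> i; apply: contrapT => iN; apply: noi; exists i => N.
  apply: contrapT => Nk; apply: iN; exists N => k kN Sik; apply: Nk.
  by exists k.
have /finite_seqP[s sE] := finite_image N finD.
have [K _ KD] := usD.
have [i Di Sik] := KD (maxn K (\max_(j <- s) j)) (leq_maxl _ _).
apply: NS Sik; apply: leq_trans (leq_maxr _ _).
apply: leq_bigmax_seq => //.
by have : [set` s] (N i) by rewrite -sE; exists i.
Qed.

(** Lower semicontinuity of the tangent spaces of the strata, across strata as
    well: this is the form in which the Whitney-(a) property is used. *)
Lemma whitney_tangent_limits (I : Type) (X : set 'rV[R]_m)
    (S : I -> set 'rV[R]_m) i u v us :
  whitney_stratification X S -> S i u -> tangent (S i) u v ->
  (forall k, X (us k)) -> us @ \oo --> u ->
  exists phi j vs, [/\ forall k, (k <= phi k)%N, forall k, S j (us (phi k)),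
    forall k, tangent (S j) (us (phi k)) (vs k) & vs @ \oo --> v].
Proof.
move=> [[[SX _ _] locfin mfd _] whit] Siu Tv Xus usu.
have Xu : X u by rewrite -SX; exists i.
have [U Uu finU] := locfin u Xu.
have [j jfreq] : exists j, forall N, exists2 k, (N <= k)%N & S j (us k).
  apply: frequently_one_piece finU _.
  have : \forall k \near \oo, U (us k) by exact: usu.
  apply: filterS => k Uk; have := Xus k; rewrite -SX => -[j _ Sjk].
  by exists j => //; exists (us k).
have [psi kpsi Spsi] := frequently_subseq (fun _ : nat => jfreq).
have uspsi : us (psi k) @[k --> \oo] --> u.
  exact: (cvg_comp _ _ (cvg_subseq kpsi) usu).
have [ij|ij] := pselect (j = i).
  rewrite ij in Spsi.
  have [phi [vs [kphi Tvs vsv]]] :=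
    tangent_continuous (mfd i) Siu Tv Spsi uspsi.
  exists (psi \o phi), i, vs.
  split; [|move=> k; exact: Spsi|exact: Tvs|exact: vsv].
  by move=> k; exact: leq_trans (kphi k) (kpsi _).
have uij : (closure (S j) `&` S i) u.
  split; last exact: Siu.
  move=> B Bu; have [N _ NB] : \forall k \near \oo, B (us (psi k)).
    exact: uspsi.
  by exists (us (psi N)); split; [exact: Spsi|apply: NB => /=].
have /choice[A AT] := fun k => tangent_rowspace (mfd j) (Spsi k).
have [phi [T [kphi gapT Tlim]]] := grassmannian_compact A.
have uphi : us (psi (phi k)) @[k --> \oo] --> u.
  exact: (cvg_comp _ _ (cvg_subseq kphi) uspsi).
have vT : v \in T.
  apply: (whit j i ij u uij (fun k => us (psi (phi k))) T) => //.
  by under eq_fun do rewrite AT.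
have [vs Avs vsv] := Tlim v vT.
exists (psi \o phi), j, vs; split; [|move=> k; exact: Spsi|move=> k|exact: vsv].
- by move=> k; exact: leq_trans (kphi k) (kpsi _).
- by rewrite /= AT; exact: Avs.
Qed.

End TangentLimits.

(** * Subgradients are normal to the strata of the graph *)

Section FrechetNormals.
Context {R : realType} {n : nat}.
Variable f : 'rV[R]_n -> \bar R.
Hypothesis f_gtNy : forall x, f x <> -oo%E.
Implicit Types (x y p q : 'rV[R]_n).

(** Clearing the denominator of a difference quotient whose value z may be
    +oo. *)
Lemma difference_quotient_ge (z : \bar R) (a b c e : R) : z <> -oo%E -> 0 < c ->
  ((- e)%:E <= (z - a%:E - b%:E) * (c^-1)%:E)%E <->
  ((a + b - e * c)%:E <= z)%E.
Proof.
move=> zNy c0; case: z zNy => [r _| _|//].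
- rewrite -!EFinB -EFinM !lee_fin ler_pdivlMr// mulNr.
  by split=> ?; lra.
- rewrite !addye// gt0_mulye ?lte_fin ?invr_gt0//.
  by rewrite !leey.
Qed.

Lemma dom_fine x : dom f x -> f x = (fine (f x))%:E.
Proof.
rewrite /dom/= => fx; rewrite fineK// fin_numE; apply/andP; split.
  by apply/eqP/f_gtNy.
by rewrite -ltey.
Qed.

(** The inequality also holds at y = x, where both sides agree; it is therefore
    stated on full neighbourhoods, which suits curves that may return to x. *)
Lemma frechet_subdiffP x p a : f x = a%:E ->
  frechet_subdiff f x p <->
  forall e, 0 < e ->
    \forall y \near x, ((a + dot p (y - x) - e * enorm (y - x))%:E <= f y)%E.
Proof.
move=> fx; have dx : dom f x by rewrite /dom/= fx ltry.
have yx0 y : y <> x -> 0 < enorm (y - x).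
  by move=> yx; apply: enorm_gt0; rewrite subr_eq0; apply/eqP.
split=> [[_]|xP].
- rewrite limf_einfE => sup0 e e0.
  have : ((- e)%:E < 0%:E :> \bar R)%E by rewrite lte_fin oppr_lt0.
  move=> /lt_le_trans/(_ sup0)/ereal_sup_gt[_ [V xV <-] infV].
  have : \forall y \near x, y != x -> V y by exact: xV.
  apply: filterS => y yV; have [->|yx] := eqVneq y x.
    have e0' : enorm (0 : 'rV[R]_n) = 0 by rewrite /enorm dot0l sqrtr0.
    by rewrite subrr dotC dot0l e0' mulr0 subr0 addr0 fx.
  apply/difference_quotient_ge => //; first exact/yx0/eqP.
  rewrite -fx; apply: le_trans (ltW infV) _; apply: ereal_inf_lbound.
  by exists y => //; exact: yV.
- split=> //; rewrite limf_einfE; apply/lee_addgt0Pr => e e0.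
  rewrite -leeBlDr// sub0e -EFinN; apply: le_ereal_sup_tmp.
  pose V := [set y | y != x /\
    ((a + dot p (y - x) - e * enorm (y - x))%:E <= f y)%E].
  eexists; first (exists V; [|reflexivity]).
    have := xP e e0; rewrite /V /dnbhs/= /within/=; apply: filterS => y fy yx.
    by split.
  apply: le_ereal_inf_tmp => _ [y [/eqP yx fy] <-]; rewrite fx.
  by apply/difference_quotient_ge => //; exact: yx0.
Qed.

Lemma Pi_graph_pt y : Pi (graph_pt f y) = y.
Proof. by rewrite /Pi row_mxKl. Qed.

Lemma PiB (u v : 'rV[R]_(n + 1)) : Pi (u - v) = Pi u - Pi v.
Proof. by rewrite /Pi linearB. Qed.

Lemma PiZ a (u : 'rV[R]_(n + 1)) : Pi (a *: u) = a *: Pi u.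
Proof. by rewrite /Pi linearZ. Qed.

Lemma cvg_Pi (T : Type) (F : set_system T) (FF : ProperFilter F)
    (u : T -> 'rV[R]_(n + 1)) (a : 'rV[R]_(n + 1)) :
  u @ F --> a -> Pi (u t) @[t --> F] --> Pi a.
Proof.
move=> /cvg_mxP ua; apply/cvg_mxP => i j; rewrite /Pi mxE.
by under eq_fun do rewrite mxE; exact: ua.
Qed.

Lemma dot_row_mx (p x : 'rV[R]_n) (a b : R) :
  dot (row_mx p a%:M) (row_mx x b%:M) = dot p x + a * b.
Proof.
rewrite /dot tr_row_mx mul_row_col mxE tr_scalar_mx -scalar_mxM.
by rewrite [X in _ + X]mxE mulr1n.
Qed.

Lemma right_quotient_cvg m (c : R -> 'rV[R]_m) : derivable c 0 1 ->
  t^-1 *: (c t - c 0) @[t --> (0 : R)^'+] --> derive1 c 0.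
Proof.
rewrite derive1E => cd.
have right0 : (0 : R)^'+ `=>` (0 : R)^'.
  move=> A; rewrite /dnbhs/= /at_right /within/=; apply: filterS => t At t0.
  by apply: At; rewrite gt_eqF.
apply: cvg_trans cd; apply: cvg_trans (cvg_app _ right0).
apply: near_eq_cvg; apply: nearW => t /=.
by rewrite addr0 [t *: 1]mulr1.
Qed.

(** For a curve c of the graph with velocity v, the subgradient inequality at
    c t, divided by t > 0, gives in the limit <(p, -1), v> <= e |Pi v| for every
    e > 0. *)
Lemma frechet_normal_le S x p v : dom f x -> S `<=` graph f ->
  frechet_subdiff f x p -> tangent S (graph_pt f x) v ->
  dot (row_mx p (-1)%:M) v <= 0.
Proof.
move=> dx Sf px [c cS c1]; set N := row_mx p _.
have fx := dom_fine dx; rewrite leNgt; apply/negP => Nv0.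
(* Any e with e |Pi v| < <N, v> would do. *)
pose e := dot N v / (enorm (Pi v) + 1).
have E0 : 0 < enorm (Pi v) + 1 by rewrite ltr_wpDl ?enorm_ge0.
have e0 : 0 < e by rewrite divr_gt0.
suff : dot N v <= e * enorm (Pi v).
  rewrite /e mulrAC ler_pdivlMr//; nra.
have px' := (frechet_subdiffP p fx).1 px e e0.
have cder := C1_curve_derivable cS; have [c0 _] := cS.
pose w (t : R) := t^-1 *: (c t - c 0).
have wv : w t @[t --> (0 : R)^'+] --> v.
  by rewrite -c1; exact: right_quotient_cvg.
have cx : c t @[t --> (0 : R)^'+] --> graph_pt f x.
  apply: cvg_at_right_filter; rewrite -c0.
  exact: derivable1_continuous.
apply: (ler_cvg_to (cvg_dot (cvg_cst N) wv)
  (cvgM (cvg_cst e) (cvg_enorm (cvg_Pi _ wv)))).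
have yx : Pi (c t) @[t --> (0 : R)^'+] --> x.
  by rewrite -[X in _ --> X](Pi_graph_pt x); exact: cvg_Pi.
have near_c : \forall t \near (0 : R)^'+, S (c t).
  by apply: cvg_within; exact: C1_curve_near cS.
have near_f : \forall t \near (0 : R)^'+, ((fine (f x) + dot p (Pi (c t) - x)
    - e * enorm (Pi (c t) - x))%:E <= f (Pi (c t)))%E.
  exact: yx px'.
near=> t.
have t0 : 0 < t by near: t; exact: nbhs_right_gt.
have /Sf[y dy cty] : S (c t) by near: t.
have : ((fine (f x) + dot p (Pi (c t) - x)
    - e * enorm (Pi (c t) - x))%:E <= f (Pi (c t)))%E by near: t.
move=> fy; change (dot N (w t) <= e * enorm (Pi (w t))).
move: fy; rewrite /w PiZ dotZr c0 PiB !Pi_graph_pt -cty Pi_graph_pt.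
rewrite (dom_fine dy) lee_fin => fy.
rewrite /graph_pt opp_row_mx add_row_mx -raddfB dot_row_mx.
rewrite enormZ ?invr_ge0 ?(ltW t0)//.
by rewrite [leRHS]mulrCA ler_pM2l ?invr_gt0//; lra.
Unshelve. all: by end_near. Qed.

(** The tangent space is linear, so the one-sided estimate applies to v and to
    -v. *)
Lemma frechet_normal S x p v : C1_submanifold S -> S `<=` graph f -> dom f x ->
  S (graph_pt f x) -> frechet_subdiff f x p -> tangent S (graph_pt f x) v ->
  dot (row_mx p (-1)%:M) v = 0.
Proof.
move=> Smfd Sf dx Sx px Tv; apply/le_anti/andP; split.
  exact: frechet_normal_le Tv.
rewrite -oppr_le0 -dotNr; apply: (@frechet_normal_le S x) => //.
by move: Tv; have [A ->] := tangent_rowspace Smfd Sx => /=; rewrite eqmx_opp.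
Qed.

Lemma cvg_graph_pt (xs : nat -> 'rV[R]_n) x : dom f x ->
  xs @ \oo --> x -> f (xs k) @[k --> \oo] --> f x ->
  graph_pt f (xs k) @[k --> \oo] --> graph_pt f x.
Proof.
move=> dx xsx; rewrite {1}(dom_fine dx) => fxs.
by apply: cvg_row_mx => //; apply: cvg_scalar_mx; exact: fine_cvg.
Qed.

(** Common source of the normality of limiting subgradients (t_k = 1) and of
    asymptotic ones (t_k -> 0). *)
Lemma limiting_normal (I : Type) (S : I -> set 'rV[R]_(n + 1)) i x v
    (xs ps : nat -> 'rV[R]_n) (t : nat -> R) (N : 'rV[R]_(n + 1)) :
  whitney_stratification (graph f) S -> dom f x -> S i (graph_pt f x) ->
  (forall k, frechet_subdiff f (xs k) (ps k)) ->
  xs @ \oo --> x -> f (xs k) @[k --> \oo] --> f x ->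
  t k *: row_mx (ps k) (-1)%:M @[k --> \oo] --> N ->
  tangent (S i) (graph_pt f x) v -> dot N v = 0.
Proof.
move=> whit dx Six pxs xsx fxs tN Tv.
have dxs k : dom f (xs k) by have [] := pxs k.
have [phi [j [vs [kphi Sj Tvs vsv]]]] := whitney_tangent_limits whit Six Tv
  (fun k => ex_intro2 _ _ (xs k) (dxs k) erefl) (cvg_graph_pt dx xsx fxs).
have [[[SX _ _] _ mfd _] _] := whit.
have Sf : S j `<=` graph f by move=> u Su; rewrite -SX; exists j.
have tphi : t (phi k) *: row_mx (ps (phi k)) (-1)%:M @[k --> \oo] --> N.
  exact: (cvg_comp _ _ (cvg_subseq kphi) tN).
have : dot (t (phi k) *: row_mx (ps (phi k)) (-1)%:M) (vs k)
    @[k --> \oo] --> (0 : R).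
  have normal k := frechet_normal (mfd j) Sf (dxs _) (Sj k) (pxs _) (Tvs k).
  under eq_fun => k do rewrite dotZl normal mulr0.
  exact: cvg_cst.
by move/(cvg_unique _ (cvg_dot tphi vsv)); apply.
Qed.

Lemma limiting_subdiff_normal (I : Type) (S : I -> set 'rV[R]_(n + 1))
    i x p v :
  whitney_stratification (graph f) S -> dom f x -> S i (graph_pt f x) ->
  limiting_subdiff f x p -> tangent (S i) (graph_pt f x) v ->
  dot (row_mx p (-1)%:M) v = 0.
Proof.
move=> whit dx Six [_ [xs [ps [pxs xsx fxs psp]]]] Tv.
apply: (limiting_normal (t := fun=> 1) whit dx Six pxs xsx fxs _ Tv).
under eq_fun do rewrite scale1r.
by apply: cvg_row_mx => //; exact: cvg_cst.
Qed.

Lemma asymptotic_subdiff_normal (I : Type) (S : I -> set 'rV[R]_(n + 1))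
    i x q v :
  whitney_stratification (graph f) S -> dom f x -> S i (graph_pt f x) ->
  asymptotic_subdiff f x q -> tangent (S i) (graph_pt f x) v ->
  dot (row_mx q 0%:M) v = 0.
Proof.
move=> whit dx Six [_ [ys [qs [t [[qys [_ _ t0]] ysx fys tqs]]]]] Tv.
apply: (limiting_normal (t := t) whit dx Six qys ysx fys _ Tv).
under eq_fun do rewrite scale_row_mx scale_scalar_mx mulrN1.
apply: cvg_row_mx => //; apply: cvg_scalar_mx.
by rewrite -oppr0; exact: cvgN.
Qed.

End FrechetNormals.

(** * Existence of Fréchet subgradients near a point of the domain *)

Section Existence.
Context {R : realType} {n : nat}.
Variable f : 'rV[R]_n -> \bar R.
Hypothesis f_gtNy : forall x, f x <> -oo%E.
Hypothesis f_lsc : lsc f.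
Implicit Types (x y p q : 'rV[R]_n).

Lemma lsc_nbhs_gt x b : (b%:E < f x)%E -> \forall y \near x, (b%:E < f y)%E.
Proof.
move=> bfx; have : nbhs (x, b) (~` epigraph f).
  apply: open_nbhs_nbhs; split; first exact: closed_openC.
  by rewrite /epigraph/= => /(lt_le_trans bfx); rewrite ltxx.
case=> -[A B] [/= Ax Bb] AB; apply: filterS Ax => y Ay.
rewrite ltNge; apply/negP => fyb; apply: (AB (y, b)) => //.
by split=> //=; exact: nbhs_singleton.
Qed.

(** Direct method: a minimizing sequence of f + lam |. - x|^2 on a closed ball
    has a cluster point, where closedness of the epigraph bounds f by the limit
    of the values.  The conclusion is solved for f z, so that it makes sense
    when f z = +oo. *)
Lemma lsc_penalized_min x r lam b : dom f x -> 0 <= r ->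
  (forall y, `|y - x| <= r -> (b%:E <= f y)%E) -> 0 <= lam ->
  exists y, [/\ `|y - x| <= r, dom f y & forall z, `|z - x| <= r ->
   ((fine (f y) + lam * dot (y - x) (y - x) - lam * dot (z - x) (z - x))%:E
      <= f z)%E].
Proof.
move=> dx r0 bf lam0; pose D y := dot (y - x) (y - x).
pose phi y := fine (f y) + lam * D y.
pose E := [set phi y | y in [set y | `|y - x| <= r /\ dom f y]].
have Ex : E (phi x) by exists x => //=; rewrite subrr normr0.
have Eb : has_lbound E.
  exists b => _ [y [yr dy] <-]; have := bf y yr.
  rewrite (dom_fine f_gtNy dy) lee_fin /phi => byf.
  by rewrite ler_wpDr// mulr_ge0// dot_ge0.
have infE : has_inf E by split=> //; exists (phi x).
have /choice[ys ysE] : forall k : nat, exists y, [/\ `|y - x| <= r, dom f y &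
    phi y < inf E + k.+1%:R^-1].
  move=> k; have k0 : 0 < k.+1%:R^-1 :> R by rewrite invr_gt0.
  have [_ [y [yr dy] <-] yk] := inf_adherent k0 infE.
  by exists y.
have ysC k : `|ys k| <= `|x| + r.
  have [yr _ _] := ysE k; rewrite -(subrK x (ys k)) addrC.
  by apply: le_trans (ler_normD _ _) _; rewrite lerD2l.
have [psi [y [kpsi ysy]]] := bounded_subseq ysC.
have yx : ys (psi k) - x @[k --> \oo] --> y - x.
  by apply: cvgB => //; exact: cvg_cst.
have yr : `|y - x| <= r.
  apply: (ler_cvg_to (cvg_norm yx) (cvg_cst r)).
  by apply: nearW => k; have [] := ysE (psi k).
have yepi : (f y <= (inf E - lam * D y)%:E)%E.
  pose b' k := inf E + (psi k).+1%:R^-1 - lam * D (ys (psi k)).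
  have b'b : b' k @[k --> \oo] --> inf E - lam * D y.
    rewrite /b' -{2}(addr0 (inf E)); apply: cvgB.
      apply: cvgD; first exact: cvg_cst.
      exact: (cvg_comp _ _ (cvg_subseq kpsi) cvg_harmonic).
    by apply: cvgM; [exact: cvg_cst|exact: cvg_dot].
  apply: (closed_cvg (epigraph f) f_lsc _ (y, inf E - lam * D y)
    (cvg_pair ysy b'b)).
  apply: nearW => k; have [_ dk phik] := ysE (psi k).
  rewrite /epigraph/= (dom_fine f_gtNy dk) lee_fin /b' lerBrDr.
  exact: ltW.
have dy : dom f y by rewrite /dom/=; apply: le_lt_trans yepi _; rewrite ltry.
exists y; split=> // z zr; have [dz|] := pselect (dom f z); last first.
  by rewrite /dom/= => /negP; rewrite -leNgt leye_eq => /eqP ->; rewrite leey.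
have : inf E <= phi z by apply: ge_inf => //; exists z.
move: yepi; rewrite (dom_fine f_gtNy dy) (dom_fine f_gtNy dz) !lee_fin/=.
rewrite /phi /D.
by move=> ? ?; lra.
Qed.

(** At an interior minimizer y of f + lam |. - x|^2, the vector
    - 2 lam (y - x) is a Fréchet subgradient of f.  A large lam forces the
    minimizer into the interior of the ball, since f is at least f x - e
    there. *)
Lemma frechet_subdiff_near x e : dom f x -> 0 < e ->
  exists y p, [/\ frechet_subdiff f y p, `|y - x| <= e &
    `|fine (f y) - fine (f x)| <= e].
Proof.
move=> dx e0; set a := fine (f x).
have afx : ((a - e)%:E < f x)%E.
  by rewrite (dom_fine f_gtNy dx) lte_fin ltrBlDr ltrDl.
have /nbhs_normP[r0 /= r00 fr0] := lsc_nbhs_gt afx.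
pose r := Num.min r0 e / 2.
have r_gt0 : 0 < r by rewrite divr_gt0// lt_min r00.
have min_r0 : Num.min r0 e <= r0 by rewrite ge_min lexx.
have min_e : Num.min r0 e <= e by rewrite ge_min lexx orbT.
have rr0 : r < r0 by rewrite ltr_pdivrMr//; lra.
have re : r <= e by rewrite ler_pdivrMr//; lra.
have fr y : `|y - x| <= r -> ((a - e)%:E <= f y)%E.
  move=> yr; apply: ltW; apply: fr0.
  by rewrite /= distrC; exact: le_lt_trans rr0.
(* The minimizer satisfies lam |y - x|^2 <= e, hence |y - x| < r. *)
pose lam := 2 * e / r ^+ 2.
have lam0 : 0 < lam by apply: divr_gt0; [exact: mulr_gt0|exact: exprn_gt0].
have [y [yr dy ymin]] := lsc_penalized_min dx (ltW r_gt0) fr (ltW lam0).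
pose D z := dot (z - x) (z - x).
have D0 z : 0 <= D z by exact: dot_ge0.
have fyE := dom_fine f_gtNy dy.
have fya : fine (f y) + lam * D y <= a.
  have := ymin x; rewrite subrr normr0 => /(_ (ltW r_gt0)).
  by rewrite dot0l mulr0 subr0 (dom_fine f_gtNy dx) lee_fin.
have fyb : a - e <= fine (f y).
  by have := fr y yr; rewrite fyE lee_fin.
have lamD : lam * D y <= e by lra.
have yx_lt : `|y - x| < r.
  apply: le_lt_trans (norm_le_enorm _) _.
  rewrite -(ltr_pXn2r (n := 2)) ?nnegrE ?enorm_ge0 ?(ltW r_gt0)// sqr_enorm.
  rewrite -/(D y) ltNge -(ler_pM2l lam0) divfK ?gt_eqF ?exprn_gt0// -ltNge.
  by apply: le_lt_trans lamD _; lra.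
exists y, ((- (2 * lam)) *: (y - x)); split; last 2 first.
- exact: le_trans re.
- have : 0 <= lam * D y by rewrite mulr_ge0// ltW.
  by rewrite ler_norml => ?; apply/andP; split; lra.
apply/(frechet_subdiffP f_gtNy _ fyE) => d d0.
have near_r : \forall z \near y, `|z - x| <= r.
  have rd : 0 < r - `|y - x| by rewrite subr_gt0.
  apply/nbhs_normP; exists (r - `|y - x|) => //= z yz.
  have -> : z - x = (y - x) - (y - z) by rewrite opprB [RHS]addrC addrA subrK.
  by apply: le_trans (ler_normB _ _) _; move: yz; rewrite /= => ?; lra.
have near_d : \forall z \near y, lam * enorm (z - y) < d.
  have : lam * enorm (z - y) @[z --> y] --> (0 : R).
    have <- : lam * enorm (y - y) = 0.
      by rewrite subrr /enorm dot0l sqrtr0 mulr0.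
    have zy : z - y @[z --> y] --> y - y.
      apply: (@cvgB _ _ _ (nbhs y) _ id (fun=> y)); first exact: cvg_id.
      exact: cvg_cst.
    exact: (cvgM (cvg_cst lam) (cvg_enorm zy)).
  by move=> /cvgr_lt; apply.
near=> z.
have zr : `|z - x| <= r by near: z.
have zd : lam * enorm (z - y) < d by near: z.
apply: le_trans (ymin z zr); rewrite lee_fin.
have zx : z - x = (z - y) + (y - x) by rewrite addrA subrK.
rewrite zx; move: zd (enorm_ge0 (z - y)).
move: (z - y) (y - x) => w u wd w0.
rewrite dotZl dotDl !dotDr (dotC w u) -(sqr_enorm w).
nra.
Unshelve. all: by end_near. Qed.

(** The subgradients obtained near x may be unbounded; the factor t_k is
    1/(k+1) divided by a nondecreasing majorant C k of the norm of the k-th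
    one. *)
Lemma asymptotic_subdiff0 x : dom f x -> asymptotic_subdiff f x 0.
Proof.
move=> dx.
have /choice[yq yqE] : forall k : nat, exists yq : 'rV[R]_n * 'rV[R]_n,
    [/\ frechet_subdiff f yq.1 yq.2, `|yq.1 - x| <= k.+1%:R^-1 &
      `|fine (f yq.1) - fine (f x)| <= k.+1%:R^-1].
  move=> k; have k0 : 0 < k.+1%:R^-1 :> R by rewrite invr_gt0.
  by have [y [p [yp yx fyx]]] := frechet_subdiff_near dx k0; exists (y, p).
pose C k : R := 1 + \sum_(i < k.+1) `|(yq i).2|.
have C_ge1 k : 1 <= C k by rewrite lerDl sumr_ge0.
have C_gt0 k : 0 < C k by apply: lt_le_trans (C_ge1 k).
have CS k : C k.+1 = C k + `|(yq k.+1).2| by rewrite /C big_ord_recr/= addrA.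
have qC k : `|(yq k).2| <= C k.
  by rewrite /C big_ord_recr/= addrA lerDr addr_ge0// sumr_ge0.
pose t k : R := (k.+1%:R * C k)^-1.
have kC_gt0 k : 0 < k.+1%:R * C k by rewrite mulr_gt0.
split=> //; exists (fun k => (yq k).1), (fun k => (yq k).2), t; split.
- split; [by move=> k; have [] := yqE k|split].
  + by move=> k; rewrite invr_gt0.
  + apply/nonincreasing_seqP => k; rewrite lef_pV2 ?posrE// ler_pM ?ler0n//.
    * by rewrite ltW.
    * by rewrite ler_nat.
    * by rewrite CS lerDl.
  + apply: cvg_harmonic_dist => k.
    rewrite sub0r normrN ger0_norm ?invr_ge0 ?(ltW (kC_gt0 k))//.
    by rewrite lef_pV2 ?posrE// -[leLHS]mulr1 ler_pM2l.
- by apply: cvg_harmonic_dist => k; rewrite distrC; have [] := yqE k.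
- rewrite (dom_fine f_gtNy dx).
  have -> : (fun k => f (yq k).1) = (fun k => (fine (f (yq k).1))%:E).
    by apply/funext => k; apply: dom_fine => //; have [[]] := yqE k.
  apply: cvg_EFin; first by apply: nearW.
  apply: cvg_harmonic_dist => k.
  by rewrite /= distrC; have [] := yqE k.
- apply: cvg_harmonic_dist => k.
  rewrite sub0r normrN normrZ ger0_norm ?invr_ge0 ?(ltW (kC_gt0 k))//.
  rewrite /t invfM -mulrA ler_piMr ?invr_ge0//.
  by rewrite mulrC ler_pdivrMr// mul1r.
Qed.

End Existence.

(** * Projection onto the tangent space of a projected stratum *)

Lemma is_derive_coord (R : realType) m (c : R -> 'rV[R]_m) t i j :
  derivable c t 1 -> is_derive t 1 (fun s => c s i j) (derive1 c t i j).
Proof.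
rewrite derive1E => /cvg_mxP/(_ i j).
under eq_fun do rewrite !mxE.
move=> cd; apply: DeriveDef; last exact: cvg_lim cd.
by apply/cvg_ex; eexists; exact: cd.
Qed.

Section Rowspaces.
Context {R : realType} {m n : nat}.
Variable B : 'M[R]_(n, m).
Implicit Types (p g v w : 'rV[R]_m).
Let V : set 'rV[R]_m := [set v | (v <= B)%MS].

Lemma rowspace_dot_eq g g' : V g -> V g' ->
  (forall w, V w -> dot g w = dot g' w) -> g = g'.
Proof.
move=> Vg Vg' gg'; apply/eqP; rewrite -subr_eq0; apply/eqP/dot_eq0.
rewrite dotBl gg' ?subrr// /V/=; apply: addmx_sub => //.
by rewrite eqmx_opp.
Qed.

Lemma orth_proj_rowspace p g : V g -> (forall w, V w -> dot p w = dot g w) ->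
  orth_proj V p = g.
Proof.
move=> Vg pg; apply: xget_unique => [|g' [Vg' g'p]].
  by split=> // w Vw; rewrite dotBl pg// subrr.
apply: rowspace_dot_eq => // w Vw.
by apply/eqP; rewrite -pg// eq_sym -subr_eq0 -dotBl g'p.
Qed.

End Rowspaces.

Section ProjectedStratum.
Context {R : realType} {n : nat}.
Variables (f : 'rV[R]_n -> \bar R) (S : set 'rV[R]_(n + 1)) (x : 'rV[R]_n).
Hypothesis Smfd : C1_submanifold S.
Hypothesis Sf : S `<=` graph f.
Hypothesis Sx : S (graph_pt f x).

Definition height (u : 'rV[R]_(n + 1)) : R := rsubmx u 0 0.

Lemma dot_row_mx_height p (a : R) v :
  dot (row_mx p a%:M) v = dot p (Pi v) + a * height v.
Proof.
by rewrite -{1}(hsubmxK v) [rsubmx v]mx11_scalar dot_row_mx.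
Qed.

Lemma proj_tangent_rowspace :
  exists B : 'M[R]_(n + 1, n), proj_tangent f S x = [set v | (v <= B)%MS].
Proof.
have [A TA] := tangent_rowspace Smfd Sx.
pose L : 'M[R]_(n + 1, n) := col_mx 1%:M 0.
have PiE u : Pi u = u *m L.
  by rewrite -{2}(hsubmxK u) mul_row_col mulmx1 mulmx0 addr0.
exists (A *m L); apply/seteqP; split=> v /=.
  by case=> u; rewrite TA/= => uA <-; rewrite PiE submxMr.
case/submxP => y ->; exists (y *m A); first by rewrite TA /= submxMl.
by rewrite PiE mulmxA.
Qed.

(** On the graph, the value of f is the last coordinate. *)
Lemma stratum_curve_derive c : C1_curve_at S (graph_pt f x) c ->
  is_derive (0 : R) 1 (fun t => fine (f (Pi (c t)))) (height (derive1 c 0)).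
Proof.
move=> cS; have cd := C1_curve_derivable cS.
have := is_derive_coord 0 (rshift n 0) cd; rewrite /height mxE.
apply: near_eq_is_derive.
apply: filterS (C1_curve_near cS) => t /Sf[y _ <-].
by rewrite Pi_graph_pt /graph_pt row_mxEr mxE eqxx mulr1n.
Qed.

(** The vectors p such that (p, -1) is normal to S at the point of the graph
    over x. *)
Definition conormal_slice : set 'rV[R]_n :=
  [set p | forall v, tangent S (graph_pt f x) v -> dot p (Pi v) = height v].

(** For p in the slice, v |-> <p, v> is the differential of f along the
    projected stratum; the gradient and the projection of p are then the same
    vector, the one of the tangent space representing this form. *)
Lemma orth_proj_conormal_slice p : conormal_slice p ->
  orth_proj (proj_tangent f S x) p = riemannian_gradient f S x.
Proof.
move=> px.
have diffE v : proj_tangent f S x v -> stratum_diff f S x v = dot p v.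
  move=> [u [c cx cu] uv]; apply: xget_unique => [|a [c' [c'x c'v fa]]].
    exists c; split; [exact: cx|by rewrite cu|].
    have := stratum_curve_derive cx; rewrite cu -uv px//.
    by exists c.
  have fa' := stratum_curve_derive c'x.
  rewrite -(@derive_val _ _ _ _ _ _ _ fa) (@derive_val _ _ _ _ _ _ _ fa').
  by rewrite -px ?c'v//; exists c'.
have [B TB] := proj_tangent_rowspace.
have [P [PB BP Pdot]] := orthogonal_projector B.
have gp w : (w <= B)%MS -> dot p w = dot (p *m P) w.
  by move=> wB; apply/eqP; rewrite -subr_eq0 -dotBl Pdot.
transitivity (p *m P); first by rewrite TB; exact: orth_proj_rowspace (BP p) gp.
apply/esym; apply: xget_unique => [|g [gT gdiff]].
  split; first by rewrite TB; exact: BP.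
  by move=> v vT; rewrite diffE// gp//; move: vT; rewrite TB.
move: gT; rewrite TB => gB; apply: (rowspace_dot_eq gB (BP p)) => w wB.
by rewrite gdiff ?diffE ?gp// TB.
Qed.

Lemma conormal_slice_convex :
  convex_set (conormal_slice : set (convex_lmodType 'rV[R]_n)).
Proof.
move=> p q t /set_mem pS /set_mem qS; apply/mem_set => v Tv.
by rewrite dotDl !dotZl pS// qS// -mulrDl addrC subrK mul1r.
Qed.

Lemma conormal_slice_closed : closed conormal_slice.
Proof.
have -> : conormal_slice = \bigcap_(v in tangent S (graph_pt f x))
    [set p | dot p (Pi v) = height v] by [].
apply: closed_bigI => v _.
have dotv : continuous (fun p : 'rV[R]_n => dot p (Pi v)).
  by move=> p; apply: (cvg_dot (F := nbhs p)); [exact: cvg_id|exact: cvg_cst].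
apply: (closed_comp (D := [set height v])) => [p _|]; first exact: dotv.
exact: closed_eq.
Qed.

End ProjectedStratum.

Theorem proposition4 (R : realType) (n : nat) (f : 'rV[R]_n -> \bar R)
    (I : Type) (S : I -> set 'rV[R]_(n + 1))
    (f_gtNy : forall x, f x <> -oo%E)
    (f_lsc : lsc f)
    (S_whitney : whitney_stratification (graph f) S)
    (S_nonvertical : forall i u, S i u -> ~ tangent (S i) u e_last) :
  forall (x : 'rV[R]_n) (i : I), dom f x -> S i (graph_pt f x) ->
    let TxX := proj_tangent f (S i) x in
    let grad := riemannian_gradient f (S i) x in
    [/\ [set orth_proj TxX p | p in limiting_subdiff f x] `<=` [set grad],
        [set orth_proj TxX q | q in asymptotic_subdiff f x] = [set 0]
      & [set orth_proj TxX p | p in clarke_subdiff f x] `<=` [set grad]].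
Proof.
move=> x i dx Six TxX grad.
have [[[SX _ _] _ mfd _] _] := S_whitney.
have Sf : S i `<=` graph f by move=> u Su; rewrite -SX; exists i.
have lim_slice p : limiting_subdiff f x p -> conormal_slice f (S i) x p.
  move=> px v Tv; have := limiting_subdiff_normal f_gtNy S_whitney dx Six px Tv.
  by rewrite dot_row_mx_height mulN1r => /eqP; rewrite subr_eq0 => /eqP.
have asym0 q v : asymptotic_subdiff f x q -> tangent (S i) (graph_pt f x) v ->
    dot q (Pi v) = 0.
  move=> qx Tv; have := asymptotic_subdiff_normal f_gtNy S_whitney dx Six qx Tv.
  by rewrite dot_row_mx_height mul0r addr0.
have projE := orth_proj_conormal_slice (mfd i) Sf Six.
have [B TB] := proj_tangent_rowspace (mfd i) Six.
have asym_proj q : asymptotic_subdiff f x q -> orth_proj TxX q = 0.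
  move=> qx; rewrite /TxX TB; apply: orth_proj_rowspace; first exact: sub0mx.
  move=> w; change ([set v | (v <= B)%MS] w -> dot q w = dot 0 w).
  by rewrite -TB dot0l => -[v Tv <-]; exact: asym0.
split.
- by move=> _ [p px <-]; apply: projE; exact: lim_slice.
- apply/seteqP; split=> [_ [q qx <-]|_ ->]; first exact: asym_proj.
  have q0 := asymptotic_subdiff0 f_gtNy f_lsc dx.
  by exists 0; [exact: q0|exact: asym_proj].
- move=> _ [p px <-]; apply: projE.
  have closed_slice := @conormal_slice_closed _ _ f (S i) x.
  rewrite ((closure_id _).1 closed_slice).
  apply: closure_subset px; apply: smallest_sub.
    exact: conormal_slice_convex.
  move=> _ [a ax [b bx <-]] v Tv.
  by rewrite dotDl (lim_slice a ax v Tv) (asym0 b v bx Tv) addr0.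
Qed.
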